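(* Algorithm WPDT (described in the context) outputs the weighted power domination number $\gamma_p^w(T)$ of any weighted tree $T=(V,E,w)$ (given with a tree ordering of its vertices) in linear time $O(m+n)$, where $n=|V|$ and $m=|E|$.
   Context: Power domination: let $G$ be a finite simple graph and $S\subseteq V(G)$. (OR 1) Initially, each vertex $v\in S$ observes itself and all its neighbors. (OR 2) Recursively, whenever an observed vertex has exactly one unobserved neighbor $u$, the vertex $u$ becomes observed. $S$ is a power dominating set of $G$ if all vertices of $G$ eventually become observed. For a weighted graph $G=(V,E,w)$, where $w$ is a function from $V$ to the positive real numbers, put $w(S)=\sum_{v\in S}w(v)$ for $S\subseteq V$, and $\gamma_p^w(G)=\min\{w(S): S \text{ is a power dominating set of } G\}$. Tree ordering: an ordering $v_1,\dots,v_n$ of the vertices of a tree such that for each $1\le i\le n-1$, $v_i$ is adjacent to exactly one $v_j$ with $j>i$; this $v_j$ is called the father of $v_i$, written $F(v_i)=v_j$. Algorithm WPDT. Input: a weighted tree $T=(V,E,w)$ with a tree ordering $v_1,\dots,v_n$. For each $i=1,\dots,n$, maintain a vector $(x_{i,1},x_{i,2},x_{i,3},x_{i,4},x_{i,5})$ with entries in $\mathbb{R}_{\ge0}\cup\{\infty\}$, initialized to $(w(v_i),\infty,\infty,0,\infty)$. For $j=1,2,\dots,n-1$ in this order, let $k$ be the index with $v_k=F(v_j)$, and replace the vector of $v_k$ simultaneously by the following values (the right-hand sides use the values before the replacement): $$x_{k,1}:=x_{k,1}+\min_{1\le m\le5}x_{j,m},$$ $$x_{k,2}:=\min\Big\{x_{k,2}+\min_{1\le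 m\le3}x_{j,m},\ x_{k,4}+\min_{1\le m\le2}x_{j,m}\Big\},$$ $$x_{k,3}:=\min\Big\{x_{k,2}+\min_{4\le m\le5}x_{j,m},\ x_{k,3}+\min_{1\le m\le3}x_{j,m},\ x_{k,5}+\min_{1\le m\le2}x_{j,m}\Big\},$$ $$x_{k,4}:=x_{k,4}+x_{j,3},$$ $$x_{k,5}:=\min\Big\{x_{k,4}+\min_{4\le m\le5}x_{j,m},\ x_{k,5}+x_{j,3}\Big\}.$$ Output: $\min\{x_{n,1},x_{n,2},x_{n,3}\}$. Each arithmetic operation or comparison counts as one unit of time. *)

(* Defs.v *)
From HB Require Import structures.
From mathcomp Require Import all_boot all_order all_algebra.
From mathcomp Require Import boolp reals constructive_ereal.

Set Implicit Arguments.
Unset Strict Implicit.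
Unset Printing Implicit Defensive.

Import Order.TTheory GRing.Theory Num.Theory.

Section Graphs.
Variables (T : finType) (e : rel T).

Definition simple_graph : Prop := symmetric e /\ irreflexive e.

Definition is_connected : Prop := forall x y : T, connect e x y.

(* [ucycle e c] with [size c <= 2] is no cycle of a simple graph: it is empty,
   or a single edge traversed back and forth. *)
Definition acyclic : Prop := forall c : seq T, ucycle e c -> (size c <= 2)%N.

(* Nonemptiness is part of the notion of tree. *)
Definition is_tree : Prop :=
  [/\ simple_graph, (0 < #|T|)%N, is_connected & acyclic].

Definition edges : {set {set T}} :=
  [set [set p.1; p.2] | p in [pred p : T * T | e p.1 p.2]].

Definition nbhd (x : T) : {set T} := [set y | e x y].

(* (OR 1) *)
Definition observed0 (S : {set T}) : {set T} := S :|: \bigcup_(x in S) nbhd x.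

(* One simultaneous round of (OR 2): [u] is added when it is the only
   unobserved neighbour of some observed vertex. *)
Definition observe (X : {set T}) : {set T} :=
  X :|: [set u | [exists x in X, nbhd x :\: X == [set u]]].

Definition power_dominating (S : {set T}) : Prop :=
  exists k : nat, iter k observe (observed0 S) = [set: T].

Lemma power_dominatingT : power_dominating [set: T].
Proof. by exists 0; rewrite /= /observed0 setTU. Qed.

End Graphs.

Section PowerDominationNumber.
Local Open Scope ring_scope.
Variables (R : realType) (T : finType) (e : rel T) (w : T -> R).

Definition weight (S : {set T}) : R := \sum_(x in S) w x.

(* The default value [setT] is itself power dominating, so this is the minimum;
   see [gamma_pwP]. *)
Definition gamma_pw : R :=
  weight [arg min_(S < [set: T] | `[< power_dominating e S >]) weight S]%O.

Lemma gamma_pwP :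
  (exists2 S, power_dominating e S & gamma_pw = weight S) /\
  (forall S, power_dominating e S -> gamma_pw <= weight S).
Proof.
rewrite /gamma_pw; case: arg_minP => [|S /asboolP PS minS].
  by apply/asboolP; exact: power_dominatingT.
by split=> [|S' PS']; [exists S | apply/minS/asboolP].
Qed.

End PowerDominationNumber.

(* The vertices are numbered from 0 to n instead of from 1, so #|T| = n.+1 and the last
   vertex is [v ord_max]. *)
Definition tree_ordering (T : finType) (e : rel T) (n : nat)
    (v : 'I_n.+1 -> T) : Prop :=
  bijective v /\
  forall j : 'I_n.+1, (j < n)%N ->
    #|[set k : 'I_n.+1 | (j < k)%N && e (v j) (v k)]| = 1.

(* The graph is presented to the algorithm by adjacency lists, in terms of the
   indices of the vertices; each list may be in any order. *)
Definition adjacency_lists (T : finType) (e : rel T) (n : nat)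
    (v : 'I_n.+1 -> T) (adj : 'I_n.+1 -> seq 'I_n.+1) : Prop :=
  forall i, uniq (adj i) /\ forall k, (k \in adj i) = e (v i) (v k).

(* Computations with a running time: a pair (time, value). *)
Definition timed (A : Type) : Type := (nat * A)%type.
Definition time A (m : timed A) : nat := m.1.
Definition value A (m : timed A) : A := m.2.

Definition ret A (a : A) : timed A := (0, a).
Definition tick A (t : nat) (a : A) : timed A := (t, a).
Definition bind A B (m : timed A) (f : A -> timed B) : timed B :=
  (time m + time (f (value m)), value (f (value m))).

Notation "'let!' x ':=' m 'in' k" := (bind m (fun x => k))
  (at level 200, x name, m at level 100, k at level 200).

Fixpoint foldT A B (f : A -> B -> timed B) (s : seq A) (b : B) : timed B :=
  if s is a :: s' then let! b' := f a b in foldT f s' b' else ret b.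

Section WPDT.
Variable R : realType.

Definition addT (x y : \bar R) : timed (\bar R) := tick 1 (x + y)%E.
Definition minT (x y : \bar R) : timed (\bar R) := tick 1 (Order.min x y).

(* Minimum of the nonempty list x :: s, with size s comparisons. *)
Definition minsT (x : \bar R) (s : seq (\bar R)) : timed (\bar R) :=
  foldT (fun y m => minT m y) s x.

Record vec := Vec { x1 : \bar R; x2 : \bar R; x3 : \bar R;
                    x4 : \bar R; x5 : \bar R }.

(* The new vector of the father, from its current vector [a] and the vector [b]
   of the child. The minima [minIJ] are computations, paid for at each use. *)
Definition update (a b : vec) : timed vec :=
  let min15 := minsT (x1 b) [:: x2 b; x3 b; x4 b; x5 b] in
  let min13 := minsT (x1 b) [:: x2 b; x3 b] in
  let min12 := minsT (x1 b) [:: x2 b] in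
  let min45 := minsT (x4 b) [:: x5 b] in
  let! y1 := bind min15 (addT (x1 a)) in
  let! p2 := bind min13 (addT (x2 a)) in
  let! q2 := bind min12 (addT (x4 a)) in
  let! y2 := minT p2 q2 in
  let! p3 := bind min45 (addT (x2 a)) in
  let! q3 := bind min13 (addT (x3 a)) in
  let! r3 := bind min12 (addT (x5 a)) in
  let! y3 := minsT p3 [:: q3; r3] in
  let! y4 := addT (x4 a) (x3 b) in
  let! p5 := bind min45 (addT (x4 a)) in
  let! q5 := addT (x5 a) (x3 b) in
  let! y5 := minT p5 q5 in
  ret (Vec y1 y2 y3 y4 y5).

Variable n : nat.

Definition ltT (j k : 'I_n.+1) : timed bool := tick 1 (j < k)%N.

(* The father of j is its only neighbour of larger index: it is searched for in
   the adjacency list of j, each comparison of indices being paid for. *)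
Fixpoint find_father (j : 'I_n.+1) (s : seq 'I_n.+1) :
    timed (option 'I_n.+1) :=
  if s is k :: s' then
    let! b := ltT j k in if b then ret (Some k) else find_father j s'
  else ret None.

(* A random-access array of vectors. *)
Definition store := 'I_n.+1 -> vec.
Definition write (x : store) (k : 'I_n.+1) (a : vec) : store :=
  fun i => if i == k then a else x i.

(* One unit of time for each entry of the array. *)
Definition init (w : 'I_n.+1 -> R) : timed store :=
  tick n.+1 (fun i => Vec (w i)%:E +oo%E +oo%E 0%E +oo%E).

(* One iteration of the main loop; one unit of time is added for the loop
   control. [None] does not occur when adj comes from a tree ordering. *)
Definition WPDT_step (adj : 'I_n.+1 -> seq 'I_n.+1) (j : 'I_n.+1) (x : store) :
    timed store :=
  let! _ := tick 1 tt in
  let! ok := find_father j (adj j) in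
  if ok is Some k then let! a := update (x k) (x j) in ret (write x k a)
  else ret x.

(* The main loop runs over all indices but the last one, in increasing order. *)
Definition WPDT (w : 'I_n.+1 -> R) (adj : 'I_n.+1 -> seq 'I_n.+1) :
    timed (\bar R) :=
  let! x0 := init w in
  let! x := foldT (WPDT_step adj)
              [seq widen_ord (leqnSn n) j | j <- enum 'I_n] x0 in
  minsT (x1 (x ord_max)) [:: x2 (x ord_max); x3 (x ord_max)].

End WPDT.

(* Main.v *)
Require Import Defs.
From mathcomp Require Import all_boot all_order all_algebra.
From mathcomp Require Import boolp reals constructive_ereal.
From mathcomp Require Import zify.

(** Fix a set [S] of vertices and look at the tree from the leaves up. What the
    rest of the tree has to know about the part below a vertex [i] is one of
    five things: [i] is in [S], or else it does or does not get observed by one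
    of its children, and it does or does not have to force one of them later.
    The state of [i] is determined by those of its children, and it can be
    computed by reading them one at a time: [merge] is the transition function
    of this finite automaton, with a sixth state [Failed] for a vertex that
    would have to force two of its children.

    Correctness has two independent halves.

    The first half is about graphs: [S] is power dominating if and only if the
    root ends in one of the first three states ([power_dominatingE]). If it
    does, a bottom-up pass shows that the vertices said to be observed from
    below are observed ([observed_from_below]), and a top-down pass that each
    remaining vertex is then observed by its father ([all_observed]). Conversely,
    a vertex that is not observed from below can only be observed by its
    father, which belongs to [S] or has all its other neighbours observed
    already ([needy_forced_by_father], by induction on time). So the root is
    observed from below, and two siblings cannot both wait for a father outside
    [S], as each would have to be observed before the other
    ([power_dominating_alive]).

    The second half is about the min-plus recursion: [update] minimizes, for
    each state, over all pairs of states that [merge] sends to it ([update_le],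
    [update_attained]). Hence the entries are the least weights of the sets
    that produce the corresponding states ([entry_le], [entry_attained]); sets
    that are optimal below distinct children can be glued because these parts
    of the tree are disjoint ([children_disjoint]) and a state depends only on
    the part of the set below the vertex ([tree_fold_local]). The total weight
    is recovered at the root by [tree_fold_sum].

    The array in which the algorithm stores its vectors, the states and the
    partial weights are all instances of one loop, [tree_fold], which solves
    the evident recursion over the children ([tree_foldE]).

    As for time, an update takes 25 operations, and the search for fathers
    reads each adjacency list at most once; in total these lists have at most
    two entries for each vertex, as every entry joins some vertex to its father
    ([sum_adj]). *)

Set Implicit Arguments.
Unset Strict Implicit.
Unset Printing Implicit Defensive.

Import Order.TTheory GRing.Theory Num.Theory.

(** * Bottom-up computations on a tree *)

Section TreeFold.
Variables (n : nat) (f : 'I_n.+1 -> 'I_n.+1).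

Definition nonroots : seq 'I_n.+1 :=
  [seq widen_ord (leqnSn n) j | j <- enum 'I_n].

Definition children (i : 'I_n.+1) : seq 'I_n.+1 :=
  [seq j <- nonroots | f j == i].

Definition fold_step A (upd : A -> A -> A) (x : 'I_n.+1 -> A) (j : 'I_n.+1) :=
  fun i => if i == f j then upd (x (f j)) (x j) else x i.

Definition tree_fold A (upd : A -> A -> A) (x : 'I_n.+1 -> A) :=
  foldl (fold_step upd) x nonroots.

Lemma mem_nonroots j : (j \in nonroots) = (j < n).
Proof.
apply/mapP/idP => [[i _ ->]|lt_jn]; first exact: ltn_ord i.
by exists (Ordinal lt_jn); [rewrite mem_enum | exact: val_inj].
Qed.

Lemma nonroots_uniq : uniq nonroots.
Proof.
rewrite map_inj_uniq ?enum_uniq // => i j /(congr1 val) /= eq_ij.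
exact: val_inj.
Qed.

Lemma nonroots_sorted : sorted (fun i j : 'I_n.+1 => i < j) nonroots.
Proof.
have -> : (fun i j : 'I_n.+1 => i < j) = relpre val ltn by [].
rewrite -sorted_map -map_comp (_ : map _ _ = iota 0 n) ?iota_ltn_sorted //.
by rewrite -val_enum_ord; exact: eq_map.
Qed.

Lemma mem_children i j : (j \in children i) = (j < n) && (f j == i).
Proof. by rewrite mem_filter mem_nonroots andbC. Qed.

Lemma children_uniq i : uniq (children i).
Proof. by rewrite filter_uniq ?nonroots_uniq. Qed.

Hypothesis f_gt : forall j : 'I_n.+1, j < n -> j < f j.

Lemma child_lt i j : j \in children i -> j < i.
Proof. by rewrite mem_children => /andP[/f_gt + /eqP <-]. Qed.

Lemma bottom_up_ind (P : 'I_n.+1 -> Prop) :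
  (forall i, (forall j, j \in children i -> P j) -> P i) -> forall i, P i.
Proof.
move=> IH i; have [m] := ubnP (val i); elim: m i => // m IHm i lt_im.
by apply: IH => j /child_lt lt_ji; apply/IHm/(leq_trans lt_ji).
Qed.

(** Every child precedes its own father in the list, so its entry is final when
    it is read: the loop therefore computes the solution of a recursion over the
    children. *)
Lemma tree_foldE A (upd : A -> A -> A) x i :
  tree_fold upd x i =
  foldl upd (x i) [seq tree_fold upd x j | j <- children i].
Proof.
rewrite /tree_fold /children.
have : all (fun j : 'I_n.+1 => j < n) nonroots.
  by apply/allP => j; rewrite mem_nonroots.
have := nonroots_sorted; elim/last_ind: nonroots i => [|s j IHs] // i.
rewrite (sorted_pairwise (fun _ _ _ => @ltn_trans _ _ _)).
rewrite -cats1 pairwise_cat all_cat allrel1r /= !andbT.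
move=> /andP[/allP lt_sj sorted_s] /andP[ltn_s ltn_j].
have fj_gt : j < f j by exact: f_gt.
have stable (k : 'I_n.+1) : k <= j ->
    foldl (fold_step upd) x (s ++ [:: j]) k = foldl (fold_step upd) x s k.
  rewrite cats1 foldl_rcons {1}/fold_step; case: eqP => // -> le_fj.
  by rewrite leqNgt fj_gt in le_fj.
have stable_s : [seq foldl (fold_step upd) x (s ++ [:: j]) k
                   | k <- s & f k == i] =
                [seq foldl (fold_step upd) x s k | k <- s & f k == i].
  apply/eq_in_map => k; rewrite mem_filter => /andP[_ /lt_sj lt_kj].
  exact/stable/ltnW.
rewrite filter_cat map_cat (foldl_cat upd) stable_s -IHs //; last first.
  by rewrite (sorted_pairwise (fun _ _ _ => @ltn_trans _ _ _)).
rewrite /= (eq_sym (f j)); case: ifP => [/eqP ->|ne_i].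
  by rewrite /= (stable j) // cats1 foldl_rcons /fold_step eqxx.
by rewrite cats1 foldl_rcons /= /fold_step ne_i.
Qed.

Lemma tree_fold_local A (upd : A -> A -> A) x x' i :
  (forall k, fconnect f k i -> x k = x' k) ->
  tree_fold upd x i = tree_fold upd x' i.
Proof.
elim/bottom_up_ind: i => i IH eq_x.
rewrite !tree_foldE (eq_x i) ?connect0 //; congr foldl.
apply/eq_in_map => j ch_j; apply: IH => // k le_kj; apply: eq_x.
apply: connect_trans le_kj _; move: ch_j; rewrite mem_children.
by case/andP=> _ /eqP <-; exact: fconnect1.
Qed.

(** The additive fold accumulates total weight: summing the defining recursion
    over all vertices, every value but that of the root appears on both sides,
    and cancels. *)
Lemma tree_fold_sum (V : zmodType) (x : 'I_n.+1 -> V) :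
  tree_fold +%R x ord_max = (\sum_i x i)%R.
Proof.
set W := tree_fold _ x.
have WE i : (W i = x i + \sum_(j <- children i) W j)%R.
  rewrite /W tree_foldE -/W; elim: (children i) (x i) => [|j s IHs] a /=.
    by rewrite big_nil addr0.
  by rewrite IHs big_cons addrA.
have sum_children :
    (\sum_i \sum_(j <- children i) W j = \sum_(j <- nonroots) W j)%R.
  under eq_bigr do rewrite big_filter big_mkcond.
  rewrite exchange_big /=; apply: eq_bigr => j _.
  by rewrite -big_mkcond (big_pred1 (f j)) // => i; rewrite eq_sym.
have : (\sum_i W i = \sum_i (x i + \sum_(j <- children i) W j))%R.
  by apply: eq_bigr => i _.
rewrite big_split /= sum_children big_ord_recr big_map -big_enum /=.
by rewrite [in RHS]addrC => /addrI.
Qed.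

Hypothesis f_ge : forall j : 'I_n.+1, j <= f j.

Lemma ancestor_ge x i : fconnect f x i -> x <= i.
Proof.
move=> /iter_findex <-; elim: (findex _ _ _) => //= k le_x.
exact: leq_trans le_x (f_ge _).
Qed.

Lemma child_not_above i j : j \in children i -> ~~ fconnect f i j.
Proof.
by move=> /child_lt lt_ji; apply/negP => /ancestor_ge; rewrite leqNgt lt_ji.
Qed.

(** The ancestors of a vertex form a chain, whereas two siblings are not
    comparable: their common father has a larger index than both. *)
Lemma children_disjoint i j1 j2 k : j1 \in children i -> j2 \in children i ->
  fconnect f k j1 -> fconnect f k j2 -> j1 = j2.
Proof.
wlog le_12 : j1 j2 / findex f k j1 <= findex f k j2.
  move=> sym ch1 ch2 k1 k2.
  have [le|/ltnW le] := leqP (findex f k j1) (findex f k j2); first exact: sym.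
  by apply/esym/sym.
move=> ch1 ch2 /iter_findex k1 /iter_findex.
rewrite -(subnK le_12) iterD k1; case: (_ - _) => [//|d]; rewrite iterSr.
move: (ch1); rewrite mem_children => /andP[_ /eqP ->] eq_j2.
have /negP[] := child_not_above ch2.
by rewrite -eq_j2 fconnect_iter.
Qed.
End TreeFold.

(** * States of a vertex with respect to a chosen set *)

(** The first five states are, in this order, those whose least weights are the
    entries [x_1] to [x_5] of the vector of a vertex [i]:
    - [Chosen]: [i] is in the set;
    - [Free]: [i] gets observed by a child, and all its children get observed
      without its help, so that [i] can force its father;
    - [Bound]: [i] gets observed by a child, but one of its children waits to be
      forced by [i], which needs the father of [i] to be observed first;
    - [Bare]: [i] does not get observed from below, but none of its children
      needs it;
    - [Hungry]: [i] does not get observed from below, and one of its children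
      needs to be forced by it.
    [Failed] says that some vertex outside the set, at [i] or below, would have
    to force two of its children. *)
Inductive state := Chosen | Free | Bound | Bare | Hungry | Failed.

(** These are the states of a child that observes its father. *)
Definition feeds (c : state) : bool :=
  match c with Chosen | Free => true | _ => false end.

(** These are the states of a vertex that gets observed by its father or not at
    all. *)
Definition needy (c : state) : bool :=
  match c with Bare | Hungry => true | _ => false end.

Definition failed (c : state) : bool :=
  match c with Failed => true | _ => false end.

(** The state of a vertex after one more child, in state [b], is taken into
    account. *)
Definition merge (a b : state) : state :=
  match a, b with
  | Failed, _ | _, Failed => Failed
  | Chosen, _ => Chosen
  | (Free | Bare), (Chosen | Free) => Free
  | (Bound | Hungry), (Chosen | Free) => Bound
  | _, Bound => a
  | Free, (Bare | Hungry) => Bound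
  | Bare, (Bare | Hungry) => Hungry
  | (Bound | Hungry), (Bare | Hungry) => Failed
  end.

Lemma merge_Chosen s :
  foldl merge Chosen s = if has failed s then Failed else Chosen.
Proof.
elim/last_ind: s => [//|s b IHs]; rewrite foldl_rcons has_rcons {}IHs.
by case: (has failed s); case: b.
Qed.

(** What the automaton remembers of the children of a vertex outside the set:
    has one of them observed it, and how many of them need its force. *)
Lemma merge_Bare s :
  foldl merge Bare s =
  if has failed s || (1 < count needy s) then Failed
  else if has feeds s then if has needy s then Bound else Free
  else if has needy s then Hungry else Bare.
Proof.
elim/last_ind: s => [//|s b IHs].
rewrite foldl_rcons !has_rcons -cats1 count_cat {}IHs /= addn0.
rewrite !(has_count needy).
by case: (has failed s); case: (has feeds s); case: (count needy s) => [|[|m]];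
  case: b; rewrite ?addn0 ?addn1.
Qed.

Lemma count_gt1P (T : eqType) (p : pred T) (s : seq T) : uniq s ->
  1 < count p s -> exists x y, [/\ x \in s, y \in s, p x, p y & x != y].
Proof.
move=> /(filter_uniq p); rewrite -size_filter.
have : all [in s] (filter p s).
  by apply/allP => x; rewrite mem_filter => /andP[].
have : all p (filter p s) by exact: filter_all.
case: (filter p s) => [|x [|y t]] //= /and3P[px py _] /and3P[sx sy _].
by rewrite inE negb_or -andbA => /and3P[ne_xy _ _] _; exists x, y.
Qed.

Section Labels.
Variables (n : nat) (f : 'I_n.+1 -> 'I_n.+1) (sigma : pred 'I_n.+1).
Hypothesis f_gt : forall j : 'I_n.+1, j < n -> j < f j.

Definition label : 'I_n.+1 -> state :=
  tree_fold f merge (fun i => if sigma i then Chosen else Bare).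

Lemma labelE i :
  label i =
  if has (failed \o label) (children f i) then Failed
  else if sigma i then Chosen
  else if 1 < count (needy \o label) (children f i) then Failed
  else if has (feeds \o label) (children f i) then
    if has (needy \o label) (children f i) then Bound else Free
  else if has (needy \o label) (children f i) then Hungry else Bare.
Proof.
rewrite {1}/label tree_foldE // -/label.
case: ifP => sel; rewrite ?merge_Chosen ?merge_Bare !has_map ?count_map /=.
  by case: ifP.
by case: (has (_ \o _) _).
Qed.

Lemma label_Chosen i : label i = Chosen -> sigma i.
Proof. by rewrite labelE; do 5?case: ifP. Qed.

Lemma label_sel i : sigma i -> ~~ failed (label i) -> label i = Chosen.
Proof. by move=> sel; rewrite labelE sel; case: ifP. Qed.

Lemma label_unneedy_child i j : j \in children f i ->
  label i = Free -> ~~ needy (label j).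
Proof.
move=> ch; rewrite labelE; do 4?[case: ifP => // _]; case: ifP => // + _.
by move=> /hasPn/(_ j ch).
Qed.

Lemma label_fed i : label i = Free \/ label i = Bound ->
  exists2 j, j \in children f i & feeds (label j).
Proof.
rewrite labelE => lab; apply/(@hasP _ (feeds \o label)); apply: contraPT lab.
by move=> /negbTE ->; do 4?case: ifP => _; case.
Qed.

Lemma label_failed_child i j :
  j \in children f i -> failed (label j) -> failed (label i).
Proof.
move=> ch fj; rewrite labelE (_ : has (failed \o _) _) //.
by apply/hasP; exists j.
Qed.

Lemma label_one_needy i j1 j2 : ~~ sigma i -> ~~ failed (label i) ->
  j1 \in children f i -> j2 \in children f i ->
  needy (label j1) -> needy (label j2) -> j1 = j2.
Proof.
move=> /negbTE sel; rewrite labelE sel; case: ifP => // _; case: ltnP => //.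
rewrite -size_filter => le1 _ ch1 ch2 nd1 nd2.
have : j1 \in filter (needy \o label) (children f i).
  by rewrite mem_filter /= nd1.
have : j2 \in filter (needy \o label) (children f i).
  by rewrite mem_filter /= nd2.
by case: filter le1 => [|x []] //= _; rewrite !inE => /eqP -> /eqP ->.
Qed.

Lemma label_failed i : failed (label i) ->
  (exists2 j, j \in children f i & failed (label j)) \/
  (~~ sigma i /\ exists j1 j2, [/\ j1 \in children f i, j2 \in children f i,
     needy (label j1), needy (label j2) & j1 != j2]).
Proof.
rewrite labelE; case: ifP => [/hasP[j ch fj] _|_]; first by left; exists j.
case: ifP => // /negbT sel; case: ifP => [gt1 _|_]; last by do 3?case: ifP.
by right; split=> //; apply: count_gt1P gt1; exact: children_uniq.
Qed.

Lemma label_needy i : needy (label i) ->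
  ~~ sigma i /\ forall j, j \in children f i ->
    ~~ feeds (label j) /\ ~~ failed (label j).
Proof.
rewrite labelE; case: ifP => // /hasPn nofail; case: ifP => // sel.
case: ifP => // _; case: ifP => [_|/hasPn nofeed _]; first by case: ifP.
by split=> // j ch; split; [exact: nofeed | exact: nofail].
Qed.

Lemma label_Bound i : label i = Bound ->
  ~~ sigma i /\ exists2 j, j \in children f i & needy (label j).
Proof.
rewrite labelE; case: ifP => // _; case: ifP => // sel; case: ifP => // _.
case: ifP => [_|_]; case: ifP => // /hasP nd _.
by split.
Qed.
End Labels.

(** * Propagation of observation *)

Section Propagation.
Variables (T : finType) (e : rel T).

Lemma mem_observed0 (S : {set T}) x :
  reflect (x \in S \/ exists2 y, y \in S & e y x) (x \in observed0 e S).
Proof.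
rewrite inE; apply: (iffP orP) => [[|/bigcupP[y Sy]]|[|[y Sy eyx]]];
  try by left.
  by rewrite inE; right; exists y.
by right; apply/bigcupP; exists y; rewrite ?inE.
Qed.

Lemma mem_observe (X : {set T}) x :
  reflect (x \in X \/ exists y, [/\ y \in X, e y x, x \notin X &
             forall z, e y z -> z != x -> z \in X])
          (x \in observe e X).
Proof.
apply: (iffP setUP) => [[|]|[|[y [Xy eyx Xx others]]]]; try by left.
  rewrite inE => /exists_inP[y Xy /eqP eq_x]; right; exists y.
  have : x \in nbhd e y :\: X by rewrite eq_x set11.
  rewrite !inE => /andP[Xx eyx]; split=> // z eyz; apply: contraR => Xz.
  by rewrite -in_set1 -eq_x !inE Xz.
right; rewrite inE; apply/exists_inP; exists y => //.
apply/eqP/setP => z; rewrite !inE; apply/andP/eqP => [[Xz eyz]|->//].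
by apply: contraNeq Xz => ne; exact: others.
Qed.

Lemma observe_sub (X : {set T}) : X \subset observe e X.
Proof. exact: subsetUl. Qed.

Lemma iter_observe_sub (X : {set T}) s t :
  s <= t -> iter s (observe e) X \subset iter t (observe e) X.
Proof.
move=> /subnK <-; elim: (t - s) => //= d IHd.
exact: subset_trans IHd (observe_sub _).
Qed.

(** As long as a round observes new vertices, the number of observed vertices
    grows, which it can do at most [#|T|] times. *)
Lemma observe_stable (X : {set T}) :
  exists k, observe e (iter k (observe e) X) = iter k (observe e) X.
Proof.
suff grow m : (exists k, observe e (iter k (observe e) X) =
                         iter k (observe e) X) \/
              m <= #|iter m (observe e) X|.
  have [//|] := grow #|T|.+1.
  by rewrite leqNgt ltnS max_card.
elim: m => [|m [|le_m]]; [by right | by left |].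
have [stab|grows] := eqVneq (observe e (iter m (observe e) X))
                            (iter m (observe e) X); first by left; exists m.
right; apply: leq_ltn_trans le_m _; rewrite /=; apply: proper_card.
by rewrite properEneq eq_sym grows observe_sub.
Qed.
End Propagation.

(** * The states decide power domination *)

Section StatesDecide.
Variables (T : finType) (e : rel T) (n : nat).
Variables (v : 'I_n.+1 -> T) (f : 'I_n.+1 -> 'I_n.+1) (S : {set T}).
Hypothesis v_bij : bijective v.
Hypothesis f_gt : forall j : 'I_n.+1, j < n -> j < f j.
Hypothesis adjE : forall i j,
  e (v i) (v j) = (j \in children f i) || (i \in children f j).

Let lab := label f (fun i => v i \in S).

Lemma vertexP (P : T -> Prop) : (forall i, P (v i)) -> forall x, P x.
Proof. by have [g _ gK] := v_bij; move=> Pv x; rewrite -(gK x). Qed.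

Lemma edge_child i j : j \in children f i -> e (v i) (v j).
Proof. by rewrite adjE => ->. Qed.

Lemma edge_father i j : j \in children f i -> e (v j) (v i).
Proof. by rewrite adjE orbC => ->. Qed.

Lemma child_father (j : 'I_n.+1) : j < n -> j \in children f (f j).
Proof. by rewrite mem_children => ->; rewrite eqxx. Qed.

Section Sound.
Variable O : {set T}.
Hypothesis sub0 : observed0 e S \subset O.
Hypothesis closedO : observe e O = O.

Lemma closed_force i j : e (v i) (v j) -> v i \in O ->
  (forall k, e (v i) (v k) -> k != j -> v k \in O) -> v j \in O.
Proof.
move=> eij Oi others; apply: contraT => Oj.
suff: v j \in observe e O by rewrite closedO (negbTE Oj).
apply/mem_observe; right; exists (v i); split=> //.
elim/vertexP => k eik; rewrite (bij_eq v_bij); exact: others.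
Qed.

Lemma nbr_chosen_closed i j : v i \in S -> e (v i) (v j) -> v j \in O.
Proof.
move=> Si eij; apply: (subsetP sub0); apply/mem_observed0; right.
by exists (v i).
Qed.

(** The states are predictions from below, but they hold for observation in the
    whole tree: a free vertex has all its neighbours but its father observed,
    so it forces its father unless that one is observed already. *)
Lemma observed_from_below i : ~~ failed (lab i) ->
  (~~ needy (lab i) -> v i \in O) /\
  (feeds (lab i) -> i < n -> v (f i) \in O).
Proof.
elim/(bottom_up_ind f_gt): i => i IH alive.
have alive_ch (j : 'I_n.+1) : j \in children f i -> ~~ failed (lab j).
  by move=> ch; apply: contra alive; exact: label_failed_child.
have fed : lab i = Free \/ lab i = Bound -> v i \in O.
  move=> /(label_fed f_gt)[j ch feeds_j].
  have [_] := IH j ch (alive_ch j ch); move: ch; rewrite mem_children.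
  by case/andP=> lt_jn /eqP <-; apply.
have chosen : lab i = Chosen -> v i \in S by exact: (label_Chosen f_gt).
split.
  move=> not_needy; case lab_i: (lab i) alive not_needy => // _ _.
  - apply: (subsetP sub0); apply/mem_observed0; left; exact: chosen.
  - by apply: fed; left.
  - by apply: fed; right.
case lab_i: (lab i) => // _ lt_in.
  apply: (nbr_chosen_closed (chosen _)) => //.
  exact/edge_father/child_father.
apply: (closed_force (i := i)); first exact/edge_father/child_father.
  by apply: fed; left.
move=> k; rewrite adjE => /orP[ch _|].
  by apply: (IH k ch (alive_ch k ch)).1; exact: (label_unneedy_child f_gt ch).
by rewrite mem_children => /andP[_ /eqP ->]; rewrite eqxx.
Qed.

Hypothesis root_alive : ~~ failed (lab ord_max).
Hypothesis root_unneedy : ~~ needy (lab ord_max).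

Lemma top_down_ind (P : 'I_n.+1 -> Prop) :
  P ord_max ->
  (forall i : 'I_n.+1, i < n -> (forall k : 'I_n.+1, i < k -> P k) -> P i) ->
  forall i, P i.
Proof.
move=> Proot IH i; have [m] := ubnP (n - i); elim: m i => // m IHm i le_m.
have [lt_in|le_ni] := ltnP i n; last first.
  rewrite (_ : i = ord_max) //; apply/val_inj/anti_leq.
  by rewrite -ltnS ltn_ord.
apply: IH => // k lt_ik; apply: IHm.
by rewrite (leq_trans _ (le_m : n - i <= m)) // ltn_sub2l.
Qed.

Lemma all_alive i : ~~ failed (lab i).
Proof.
elim/top_down_ind: i => // i lt_in /(_ _ (f_gt lt_in)).
by apply: contra; apply: label_failed_child => //; exact: child_father.
Qed.

(** A needy vertex whose father is not in [S] gets forced by its father, once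
    the father of that one is observed: all its siblings are observed from
    below. *)
Lemma all_observed i : v i \in O.
Proof.
have below (j : 'I_n.+1) := observed_from_below (all_alive j).
elim/top_down_ind: i => [|i lt_in IH]; first exact: (below _).1.
have [needy_i|/(below i).1 //] := boolP (needy (lab i)).
have ch_i := child_father lt_in; have lt_if := f_gt lt_in.
have [Sf|not_Sf] := boolP (v (f i) \in S).
  exact: nbr_chosen_closed Sf (edge_child ch_i).
apply: (closed_force (edge_child ch_i)); first exact: IH.
move=> k; rewrite adjE => /orP[ch_k ne_ki|].
  apply: (below k).1; apply: contra ne_ki => needy_k; apply/eqP.
  exact: (label_one_needy f_gt not_Sf (all_alive _) ch_k ch_i).
by move=> /(child_lt f_gt) lt_fk _; apply/IH/(ltn_trans lt_if).
Qed.
End Sound.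

Section Complete.
Let X t := iter t (observe e) (observed0 e S).

Lemma observed_le i s t : v i \in X s -> v i \notin X t -> t < s.
Proof.
move=> Xs; apply: contraR; rewrite -leqNgt => le_st.
exact: (subsetP (iter_observe_sub _ _ le_st)) Xs.
Qed.

(** Induction on the time [t]: no child [j] of [i] can force [i]. Such a [j] is
    needy or bound. If it is needy, it cannot be observed before [i], by
    induction. If it is bound, then one of its children is needy and, by
    induction, cannot be observed before all other neighbours of [j], one of
    which is [i]. *)
Lemma needy_forced_by_father t i : needy (lab i) -> v i \in X t ->
  i < n /\ (v (f i) \in S \/ exists s, [/\ v i \notin X s, v (f i) \in X s &
     forall j, e (v (f i)) (v j) -> j != i -> v j \in X s]).
Proof.
elim: t i => [|t IHt] i needy_i Xi.
  have [not_Si ch_i] := label_needy f_gt needy_i.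
  case/mem_observed0: Xi => [Si|[y Sy]]; first by rewrite Si in not_Si.
  elim/vertexP: y Sy => j Sj; rewrite adjE => /orP[|ch_j].
    by rewrite mem_children => /andP[lt_in /eqP eq_j]; rewrite eq_j; auto.
  have [not_feeds alive] := ch_i j ch_j.
  by rewrite [label _ _ _](label_sel f_gt) in not_feeds.
have [Xti|not_Xti] := boolP (v i \in X t); first exact: IHt Xti.
case/mem_observe: Xi => [Xti|[y [Xy]]]; first by rewrite -/(X t) Xti in not_Xti.
rewrite -/(X t) in Xy; elim/vertexP: y Xy => j Xj; rewrite adjE => + _ others.
have {}others (k : 'I_n.+1) : e (v j) (v k) -> k != i -> v k \in X t.
  by move=> ejk ne_ki; apply: others; rewrite ?(bij_eq v_bij).
case/orP=> [|ch_j].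
  rewrite mem_children => /andP[lt_in /eqP eq_j]; split=> //; right.
  by exists t; rewrite eq_j.
have [not_Si ch_i] := label_needy f_gt needy_i.
have f_j : f j = i by move: ch_j; rewrite mem_children => /andP[_ /eqP].
case/negP: not_Xti.
have ne_ki (k : 'I_n.+1) : k \in children f j -> k != i.
  move=> /(child_lt f_gt) lt_kj; rewrite neq_ltn.
  by rewrite (ltn_trans lt_kj) ?(child_lt f_gt ch_j).
have [not_feeds alive] := ch_i j ch_j.
have [needy_j|not_needy] := boolP (needy (lab j)).
  have [_ [|[s [/(observed_le Xj) /ltnW le_st Xsi _]]]] := IHt j needy_j Xj.
    by rewrite f_j (negbTE not_Si).
  by apply: (subsetP (iter_observe_sub _ _ le_st)); rewrite f_j in Xsi.
have lab_j : lab j = Bound.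
  by move: not_feeds alive not_needy; rewrite -/lab; case: (lab j).
have [not_Sj [k ch_k needy_k]] := label_Bound f_gt lab_j.
have Xk : v k \in X t by apply: others (ne_ki k ch_k); exact: edge_child.
have [_ []] := IHt k needy_k Xk.
  move: ch_k; rewrite mem_children => /andP[_ /eqP ->].
  by rewrite (negbTE not_Sj).
have -> : f k = j by move: ch_k; rewrite mem_children => /andP[_ /eqP].
case=> s [/(observed_le Xk) /ltnW le_st _ Xs].
apply: (subsetP (iter_observe_sub _ _ le_st)); apply: Xs.
  exact: edge_father.
by rewrite eq_sym ne_ki.
Qed.

(** Two needy children of a vertex outside [S] wait for each other. *)
Lemma power_dominating_alive t : X t = [set: T] -> forall i, ~~ failed (lab i).
Proof.
move=> Xt; have in_Xt x : x \in X t by rewrite Xt inE.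
elim/(bottom_up_ind f_gt) => i IH.
apply/negP => /(label_failed f_gt)[[j ch_j]|].
  by rewrite (negbTE (IH j ch_j)).
case=> not_Si [j1 [j2 [ch1 ch2 needy1 needy2 ne12]]].
have forced (j : 'I_n.+1) : j \in children f i -> needy (lab j) -> exists s,
    v j \notin X s /\ (forall k, k \in children f i -> k != j -> v k \in X s).
  move=> ch needy_j; have [_] := needy_forced_by_father needy_j (in_Xt _).
  move: (ch); rewrite mem_children => /andP[_ /eqP ->].
  rewrite (negbTE not_Si) => -[//|[s [not_Xs _ Xs]]].
  exists s; split=> // k ch_k; exact/Xs/edge_child.
have [s1 [not_X1 X1]] := forced j1 ch1 needy1.
have [s2 [not_X2 X2]] := forced j2 ch2 needy2.
have := observed_le (X1 j2 ch2 _) not_X2; rewrite eq_sym ne12 => /(_ isT).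
by have := observed_le (X2 j1 ch1 ne12) not_X1 => /ltnW; case: ltngtP.
Qed.
End Complete.

(** These are the states [Chosen], [Free] and [Bound], whose entries are
    compared to produce the output. *)
Definition dominated (c : state) : bool := ~~ failed c && ~~ needy c.

Lemma power_dominatingE : power_dominating e S <-> dominated (lab ord_max).
Proof.
split=> [[t Xt]|/andP[alive unneedy]].
  rewrite /dominated (power_dominating_alive Xt); apply/negP => needy_root.
  have [|+ _] := needy_forced_by_father (t := t) needy_root.
    by rewrite Xt inE.
  by rewrite ltnn.
have [k stab] := observe_stable e (observed0 e S); exists k.
apply/setP => x; rewrite inE; elim/vertexP: x => i.
by apply: all_observed => //; exact: (iter_observe_sub _ _ (leq0n k)).
Qed.
End StatesDecide.

(** * The dynamic program computes least weights *)

Section Entries.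
Variable R : realType.
Local Open Scope ereal_scope.

Definition entry (x : vec R) (c : state) : \bar R :=
  match c with
  | Chosen => x1 x | Free => x2 x | Bound => x3 x
  | Bare => x4 x | Hungry => x5 x
  | Failed => +oo
  end.

Lemma adde_minr (a x y : \bar R) :
  a + Order.min x y = Order.min (a + x) (a + y).
Proof.
case: (leP x y) => [le_xy|/ltW le_yx]; first by rewrite min_l // leeD2l.
by rewrite min_r // leeD2l.
Qed.

Lemma update_le (a b : vec R) c d : ~~ failed (merge c d) ->
  entry (value (update a b)) (merge c d) <= entry a c + entry b d.
Proof.
by case: c; case: d => //= _; rewrite ?adde_minr !ge_min !lexx ?orbT.
Qed.

Lemma min_cases (P : \bar R -> Prop) (x y : \bar R) :
  P x -> P y -> P (Order.min x y).
Proof. by case: leP. Qed.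

Local Ltac state_of p :=
  lazymatch p with
  | x1 _ => constr:(Chosen) | x2 _ => constr:(Free) | x3 _ => constr:(Bound)
  | x4 _ => constr:(Bare) | x5 _ => constr:(Hungry)
  end.

Lemma update_attained (a b : vec R) c : ~~ failed c ->
  exists c' d, merge c' d = c /\
    entry (value (update a b)) c = entry a c' + entry b d.
Proof.
move=> alive; suff attained (P : \bar R -> Prop) :
    (forall c' d, merge c' d = c -> P (entry a c' + entry b d)) ->
    P (entry (value (update a b)) c).
  apply: (attained (fun z => exists c' d, merge c' d = c /\ z = _)).
  by move=> c' d cd; exists c', d.
case: c alive => //= _ sums; rewrite ?adde_minr; do ?apply: min_cases.
all: lazymatch goal with |- _ (_ ?p ?q) =>
  let c := state_of p in let d := state_of q in exact: (sums c d erefl) end.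
Qed.
End Entries.

Lemma failed_merge c d :
  ~~ failed (merge c d) -> ~~ failed c /\ ~~ failed d.
Proof. by case: c; case: d. Qed.

Section LeastWeights.
Variables (R : realType) (n : nat) (f : 'I_n.+1 -> 'I_n.+1) (w : 'I_n.+1 -> R).
Hypothesis f_gt : forall j : 'I_n.+1, j < n -> j < f j.
Hypothesis f_ge : forall j : 'I_n.+1, j <= f j.
Local Open Scope ereal_scope.

Definition vectors : 'I_n.+1 -> vec R :=
  tree_fold f (fun a b => value (update a b))
    (fun i => Vec (w i)%:E +oo +oo 0 +oo).

Definition load (sigma : pred 'I_n.+1) : 'I_n.+1 -> R :=
  tree_fold f +%R (fun i => if sigma i then w i else 0%R).

Lemma entry_le sigma i : ~~ failed (label f sigma i) ->
  entry (vectors i) (label f sigma i) <= (load sigma i)%:E.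
Proof.
elim/(bottom_up_ind f_gt): i => i IH.
rewrite /label /load /vectors !tree_foldE // -/vectors -/(label f sigma)
  -/(load sigma).
have : ~~ failed (if sigma i then Chosen else Bare) ->
    entry (Vec (w i)%:E +oo +oo 0 +oo) (if sigma i then Chosen else Bare) <=
    (if sigma i then w i else 0%R)%:E by case: (sigma i) => /=.
move: (Vec _ _ _ _ _) (if sigma i then Chosen else Bare)
  (if sigma i then w i else 0%R).
elim: (children f i) IH => [|j s IHs] IH a c l le_a //=; apply: IHs.
  by move=> k sk; apply: IH; rewrite inE sk orbT.
move=> alive; have [alive_c alive_j] := failed_merge alive.
rewrite EFinD; apply: le_trans (update_le _ _ alive) _.
by apply: leeD; [exact: le_a | apply: IH; rewrite ?mem_head].
Qed.

(** Optimal sets for a prefix of the children and for the next child [j] are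
    glued by following the second one on the descendants of [j], the first
    elsewhere. *)
Lemma entry_attained i c : ~~ failed c ->
  entry (vectors i) c = +oo \/
  exists sigma, label f sigma i = c /\ entry (vectors i) c = (load sigma i)%:E.
Proof.
elim/(bottom_up_ind f_gt): i c => i IH c.
rewrite /vectors tree_foldE // -/vectors.
set x0 := Vec _ _ _ _ _.
suff prefix s : uniq s -> {subset s <= children f i} -> forall c, ~~ failed c ->
    let z := entry (foldl (fun a b => value (update a b)) x0
                      [seq vectors j | j <- s]) c in
    z = +oo \/ exists sigma : pred 'I_n.+1,
      foldl merge (if sigma i then Chosen else Bare)
        [seq label f sigma j | j <- s] = c /\
      z = (foldl +%R (if sigma i then w i else 0%R)
             [seq load sigma j | j <- s])%:E.
  have kids_uniq := children_uniq f i.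
  move=> alive.
  have [->|[sigma [lab_i z_i]]] := prefix _ kids_uniq (fun _ => id) c alive.
    by left.
  by right; exists sigma; rewrite /label /load !tree_foldE.
elim/last_ind: s => [_ _ {}c|s j IHs].
  (* without children, a vertex is chosen or bare *)
  case: c => //= _; try by left.
    by right; exists xpredT.
  by right; exists xpred0.
rewrite rcons_uniq => /andP[s'j uniq_s] sub {}c alive.
have ch_j : j \in children f i by apply: sub; rewrite mem_rcons mem_head.
have {}sub : {subset s <= children f i}.
  by move=> k sk; apply: sub; rewrite mem_rcons inE sk orbT.
rewrite map_rcons foldl_rcons.
have [c' [d [cd ->]]] := update_attained
  (foldl (fun a b => value (update a b)) x0 [seq vectors j | j <- s])
  (vectors j) alive.
move: (alive); rewrite -cd => /failed_merge[alive_c' alive_d].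
have [->|[sigma1 [lab1 ->]]] := IHs uniq_s sub _ alive_c'.
  by left; have [->|[? [_ ->]]] := IH j ch_j d alive_d.
have [->|[sigma2 [lab2 ->]]] := IH j ch_j d alive_d; first by left.
right; pose sigma k := if fconnect f k j then sigma2 k else sigma1 k.
have eq_j k : fconnect f k j -> sigma k = sigma2 k by rewrite /sigma => ->.
have eq_i : sigma i = sigma1 i.
  by rewrite /sigma (negbTE (child_not_above f_gt f_ge ch_j)).
have eq_s k l : k \in s -> fconnect f l k -> sigma l = sigma1 l.
  move=> sk le_lk; rewrite /sigma; case: ifP => // le_lj; case/negP: s'j.
  by rewrite (children_disjoint f_gt f_ge ch_j (sub _ sk) le_lj le_lk).
exists sigma; rewrite eq_i !map_rcons !foldl_rcons; split.
  rewrite -lab1 -lab2; congr merge.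
    congr foldl; apply/eq_in_map => k sk.
    by apply: tree_fold_local => // l /(eq_s _ _ sk) ->.
  by apply: tree_fold_local => // l /eq_j ->.
rewrite EFinD; congr (_%:E + _%:E).
  congr foldl; apply/eq_in_map => k sk.
  by apply: tree_fold_local => // l /(eq_s _ _ sk) ->.
by apply: tree_fold_local => // l /eq_j ->.
Qed.
End LeastWeights.

(** * Running time and output of the algorithm *)

Lemma value_bind A B (m : timed A) (g : A -> timed B) :
  value (bind m g) = value (g (value m)).
Proof. by []. Qed.

Lemma time_bind A B (m : timed A) (g : A -> timed B) :
  time (bind m g) = time m + time (g (value m)).
Proof. by []. Qed.

Lemma value_foldT A B (g : A -> B -> timed B) s b :
  value (foldT g s b) = foldl (fun b a => value (g a b)) b s.
Proof. by elim: s b => //= a s IHs b; rewrite value_bind IHs. Qed.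

Lemma time_foldT (A : eqType) B (g : A -> B -> timed B) (cost : A -> nat) s b :
  (forall a b, a \in s -> time (g a b) <= cost a) ->
  time (foldT g s b) <= \sum_(a <- s) cost a.
Proof.
elim: s b => [|a s IHs] b le_cost; first by rewrite big_nil.
rewrite time_bind big_cons leq_add ?le_cost ?mem_head // IHs // => a' b' sa'.
by rewrite le_cost // inE sa' orbT.
Qed.

Lemma value_find_father n (j : 'I_n.+1) s :
  value (find_father j s) = ohead [seq k : 'I_n.+1 <- s | j < k].
Proof. by elim: s => // k s IHs; rewrite value_bind /=; case: ifP. Qed.

Lemma time_find_father n (j : 'I_n.+1) s : time (find_father j s) <= size s.
Proof. by elim: s => // k s IHs; rewrite time_bind /=; case: ifP. Qed.

Lemma time_update (R : realType) (a b : vec R) : time (update a b) = 25.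
Proof. by []. Qed.

Lemma eq_in_foldl (A : eqType) B (g h : B -> A -> B) s b :
  (forall x a, a \in s -> g x a = h x a) -> foldl g b s = foldl h b s.
Proof.
elim: s b => //= a s IHs b eq_gh; rewrite eq_gh ?mem_head // IHs // => x c sc.
by rewrite eq_gh // inE sc orbT.
Qed.

Section Run.
Variables (R : realType) (T : finType) (e : rel T) (w : T -> R) (n : nat).
Variables (v : 'I_n.+1 -> T) (adj : 'I_n.+1 -> seq 'I_n.+1).
Hypothesis graph_e : simple_graph e.
Hypothesis order_v : tree_ordering e v.
Hypothesis adjP : adjacency_lists e v adj.

(** The vertex found by the algorithm; the last vertex, which has no father, is
    sent to itself. *)
Definition father (j : 'I_n.+1) : 'I_n.+1 :=
  odflt j (value (find_father j (adj j))).

Lemma father_ge (j : 'I_n.+1) : j <= father j.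
Proof.
rewrite /father value_find_father.
have : all (fun k : 'I_n.+1 => j < k) [seq k : 'I_n.+1 <- adj j | j < k].
  exact: filter_all.
by case: filter => //= k s /andP[/ltnW].
Qed.

Lemma fatherP (j : 'I_n.+1) : j < n ->
  value (find_father j (adj j)) = Some (father j) /\
  forall k : 'I_n.+1, (j < k) && e (v j) (v k) = (k == father j).
Proof.
move=> lt_jn; have [_ /(_ j lt_jn)/eqP/cards1P[k0 set_eq]] := order_v.
have later (k : 'I_n.+1) : (j < k) && e (v j) (v k) = (k == k0).
  by rewrite -in_set1 -set_eq inE.
have mem_later k : (k \in [seq k : 'I_n.+1 <- adj j | j < k]) = (k == k0).
  by rewrite mem_filter (adjP j).2.
rewrite /father value_find_father; case: filter mem_later => [|k s] mem_later.
  by have := mem_later k0; rewrite eqxx.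
have /eqP-> : k == k0 by rewrite -mem_later mem_head.
by split.
Qed.

Lemma father_gt (j : 'I_n.+1) : j < n -> j < father j.
Proof. by move=> /fatherP[_ /(_ (father j))]; rewrite eqxx => /andP[]. Qed.

(** All edges of the tree join a vertex to its father: the endpoint of larger
    index is the only later neighbour of the other one. *)
Lemma edgeE i j :
  e (v i) (v j) = (j \in children father i) || (i \in children father j).
Proof.
have [sym_e irr_e] := graph_e.
wlog le_ij : i j / i <= j.
  move=> IH; have [/IH //|/ltnW/IH] := leqP i j.
  by rewrite sym_e orbC.
move: le_ij; rewrite !mem_children leq_eqVlt => /orP[/eqP/val_inj <-|lt_ij].
  rewrite irr_e orbb; apply/esym/negbTE/negP => /andP[/father_gt + /eqP eq_i].
  by rewrite eq_i ltnn.
have lt_in : i < n by rewrite (leq_trans lt_ij) // -ltnS ltn_ord.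
rewrite lt_in [father i == j]eq_sym -((fatherP lt_in).2 j) lt_ij /=.
case: eqP => [eq_i|]; last by rewrite andbF.
by have := father_ge j; rewrite eq_i leqNgt lt_ij.
Qed.

Let run := WPDT (fun i => w (v i)) adj.

(** Each vertex occurs in the lists of its father and of its children only. *)
Lemma sum_adj : \sum_j size (adj j) <= n.+1 * 2.
Proof.
have size_adj j : size (adj j) <=
    \sum_k ((k \in children father j) + (j \in children father k)).
  have [uniq_j mem_j] := adjP j.
  rewrite -(card_uniqP uniq_j) -sum1_card big_mkcond leq_sum //= => k _.
  by rewrite mem_j edgeE; do 2?case: (_ \in _).
apply: leq_trans (leq_sum _ (fun j _ => size_adj j)) _.
have one_father : \sum_j \sum_k (k \in children father j) <= n.+1.
  rewrite exchange_big -[leqRHS]card_ord -sum1_card leq_sum //= => k _.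
  rewrite (bigD1 (father k)) //= big1 ?addn0 ?leq_b1 // => j ne_j.
  by rewrite mem_children eq_sym (negbTE ne_j) andbF.
rewrite muln2 -addnn.
under eq_bigr do rewrite big_split.
by rewrite big_split /= leq_add // exchange_big.
Qed.

Lemma time_run : time run <= 31 * #|T|.
Proof.
have [v_bij _] := order_v.
rewrite -(bij_eq_card v_bij) card_ord /run /WPDT !time_bind.
have -> : time (init (fun i => w (v i))) = n.+1 by [].
(* 25 for the update and 1 for the control of the loop *)
have cost_step j (x : store R n) :
    time (WPDT_step adj j x) <= 26 + size (adj j).
  rewrite /WPDT_step !time_bind -[26]/(1 + 25) -addnA leq_add2l addnC.
  apply: leq_add; last exact: time_find_father.
  by case: (value (find_father _ _)) => [k|] //; rewrite time_bind time_update.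
have sum_nonroots : \sum_(j <- nonroots n) size (adj j) <= n.+1 * 2.
  apply: leq_trans sum_adj.
  by rewrite big_map big_enum /= big_ord_recr leq_addr.
have size_nonroots : size (nonroots n) = n by rewrite size_map size_enum_ord.
have := time_foldT (value (init (fun i => w (v i))))
  (fun j x (_ : j \in nonroots n) => cost_step j x).
rewrite big_split /= big_const_seq count_predT size_nonroots iter_addn_0.
set loop := time (foldT _ _ _) => le_loop.
lia.
Qed.

Lemma value_run :
  value run =
  let x := vectors father (fun i => w (v i)) ord_max in
  Order.min (Order.min (x1 x) (x2 x)) (x3 x).
Proof.
rewrite /run /WPDT !value_bind value_foldT.
rewrite (eq_in_foldl
  (h := fold_step father (fun a b => value (update a b)))) //.
move=> x j; rewrite mem_nonroots => lt_jn.
by rewrite /WPDT_step !value_bind (fatherP lt_jn).1.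
Qed.

Lemma load_weight (S : {set T}) :
  load father (fun i => w (v i)) (fun i => v i \in S) ord_max = weight w S.
Proof.
rewrite /load tree_fold_sum; last exact: father_gt.
rewrite /weight (reindex v); last exact: onW_bij order_v.1.
by rewrite [RHS]big_mkcond.
Qed.

Lemma value_run_gamma : value run = (gamma_pw e w)%:E.
Proof.
have [v_bij _] := order_v.
have [[S0 dom0 gammaE] gamma_le] := gamma_pwP e w.
have dominatedE S := power_dominatingE S v_bij father_gt edgeE.
rewrite value_run /=; set x := vectors _ _ _.
apply: le_anti; apply/andP; split.
  rewrite gammaE -load_weight.
  have /andP[alive unneedy] := (dominatedE S0).1 dom0.
  apply: le_trans (entry_le _ father_gt alive).
  by case: label alive unneedy => // _ _; rewrite -/x !ge_min lexx ?orbT.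
have least c : dominated c -> ((gamma_pw e w)%:E <= entry x c)%E.
  move=> dom_c; have [alive _] := andP dom_c.
  have [->|[sigma [lab_c ->]]] :=
    entry_attained (fun i => w (v i)) father_gt father_ge ord_max alive.
    exact: leey.
  have sigmaE : sigma = fun i => v i \in v @: sigma.
    by apply/funext => i; rewrite mem_imset //; exact: bij_inj.
  rewrite lee_fin sigmaE load_weight; apply/gamma_le/dominatedE.
  by rewrite -sigmaE lab_c.
by rewrite !le_min (least Chosen) // (least Free) // (least Bound).
Qed.
End Run.

Theorem theorem3p1 :
  exists C : nat,
    forall (R : realType) (T : finType) (e : rel T) (w : T -> R)
      (n : nat) (v : 'I_n.+1 -> T) (adj : 'I_n.+1 -> seq 'I_n.+1),
      is_tree e ->
      (forall x : T, (0 < w x)%R) ->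
      tree_ordering e v ->
      adjacency_lists e v adj ->
      let run := WPDT (fun i => w (v i)) adj in
      value run = ((gamma_pw e w)%:E)%E /\
      (time run <= C * (#|edges e| + #|T|))%N.
Proof.
(* With N vertices: N for the initialization, at most 26 N for the loop apart
   from the search for fathers, 2 N for that search, and 2 for the final
   minimum. *)
exists 31 => R T e w n v adj [graph_e _ _ _] _ order_v adjP run.
split; first exact: value_run_gamma.
apply: leq_trans (time_run w graph_e order_v adjP) _.
by rewrite leq_mul2l leq_addl.
Qed.
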